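(* Let $\Gamma\subset\mathbb{R}^2$ be a simple closed curve such that every set of $6$ points of $\Gamma$ is in c.s.c. position. Then $\Gamma$ is the boundary of a centrally symmetric convex region (i.e., there is a point $O$ such that $\Gamma$ bounds a convex body and $2O-\Gamma=\Gamma$).
   Context: A set of points in $\mathbb{R}^2$ is in c.s.c. position (centrally symmetric convex position) if it is contained in the boundary of a centrally symmetric convex body (compact convex set with nonempty interior). *)

(* Defs.v *)
From Stdlib Require Import Reals Lra.
Open Scope R_scope.

Definition pt := (R * R)%type.
Definition pset := pt -> Prop.

Definition dist2 (p q : pt) : R :=
  sqrt ((fst p - fst q) ^ 2 + (snd p - snd q) ^ 2).

Definition comb (t : R) (x y : pt) : pt :=
  (t * fst x + (1 - t) * fst y, t * snd x + (1 - t) * snd y).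

Definition reflect (c x : pt) : pt := (2 * fst c - fst x, 2 * snd c - snd x).

Definition interior (K : pset) (x : pt) : Prop :=
  exists r, 0 < r /\ forall y, dist2 x y < r -> K y.

Definition closure (K : pset) (x : pt) : Prop :=
  forall r, 0 < r -> exists y, K y /\ dist2 x y < r.

Definition is_closed (K : pset) : Prop := forall x, closure K x -> K x.

Definition is_bounded (K : pset) : Prop :=
  exists M, forall x, K x -> dist2 (0, 0) x <= M.

Definition boundary (K : pset) (x : pt) : Prop :=
  closure K x /\ closure (fun y => ~ K y) x.

Definition convex (K : pset) : Prop :=
  forall x y t, K x -> K y -> 0 <= t <= 1 -> K (comb t x y).

Definition convex_body (K : pset) : Prop :=
  convex K /\ is_closed K /\ is_bounded K /\ exists x, interior K x.

Definition symmetric_about (c : pt) (K : pset) : Prop :=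
  forall x, K x -> K (reflect c x).

Definition centrally_symmetric (K : pset) : Prop :=
  exists c, symmetric_about c K.

Definition csc_position (S : pset) : Prop :=
  exists K, convex_body K /\ centrally_symmetric K /\ forall x, S x -> boundary K x.

Definition simple_closed_curve (G : pset) : Prop :=
  exists gamma : R -> pt,
    (forall t, 0 <= t <= 1 -> forall eps, 0 < eps ->
       exists d, 0 < d /\ forall s, 0 <= s <= 1 -> Rabs (s - t) < d ->
         dist2 (gamma s) (gamma t) < eps) /\
    gamma 0 = gamma 1 /\
    (forall s t, 0 <= s < 1 -> 0 <= t < 1 -> gamma s = gamma t -> s = t) /\
    (forall x, G x <-> exists t, 0 <= t <= 1 /\ gamma t = x).

(* Main.v *)
(* Let [o] be strictly inside a triangle with vertices on [G]. Five points of [G] are always in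
   convex position, so each ray from [o] meets [G] at most once, and it does meet [G] since a
   circle does not embed in an interval; hence [G] bounds its (convex) star hull from [o].

   Let [h] be the support function of [G] and [O] the centre of its bounding box. If
   [h v - h (- v) > 2 <v, O>] for some [v], split [- v] into its two axis components [u1], [u2] and
   put [u3 = v]: there is a point [o] with [h u_i - h (- u_i) > 2 <u_i, o>] for all three
   directions. Let [a_i] maximize [u_i] on [G]. Then [o] is strictly inside the triangle of the
   [a_i], and the chord of [G] from [a_i] through [o] ends at some [b_i] closer to [o] than [a_i].
   The six points [a_i], [b_i] are not in c.s.c. position: whatever the centre [e], some [b_i] is
   interior to the hull of [a_1], [a_2], [a_3] and the reflection of [a_i] in [e]. So
   [h v - h (- v) = 2 <v, O>] for all [v], which is the central symmetry about [O]. *)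

From Stdlib Require Import Reals Lra Lia List Classical.
Require Import Defs.
Open Scope R_scope.

(** * Triangles, distances and interiors in the plane *)

Definition dot (u x : pt) : R := fst u * fst x + snd u * snd x.

(** Twice the signed area of the triangle. *)
Definition orient (a b c : pt) : R :=
  (fst b - fst a) * (snd c - snd a) - (snd b - snd a) * (fst c - fst a).

Definition inside (a b c o : pt) : Prop :=
  orient a b c <> 0 /\
  exists r s t, 0 < r /\ 0 < s /\ 0 < t /\ r + s + t = 1 /\
    o = (r * fst a + s * fst b + t * fst c, r * snd a + s * snd b + t * snd c).

Lemma comb_0 (x y : pt) : comb 0 x y = y.
Proof. destruct y; unfold comb; simpl; f_equal; ring. Qed.

Lemma comb_1 (x y : pt) : comb 1 x y = x.
Proof. destruct x; unfold comb; simpl; f_equal; ring. Qed.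

Lemma dist2_refl (p : pt) : dist2 p p = 0.
Proof.
  unfold dist2. rewrite <- sqrt_0. f_equal. ring.
Qed.

Lemma dist2_ge_fst (p q : pt) : Rabs (fst p - fst q) <= dist2 p q.
Proof.
  unfold dist2. rewrite <- sqrt_Rsqr_abs. apply sqrt_le_1_alt.
  rewrite Rsqr_pow2. assert (H := pow2_ge_0 (snd p - snd q)). lra.
Qed.

Lemma dist2_ge_snd (p q : pt) : Rabs (snd p - snd q) <= dist2 p q.
Proof.
  unfold dist2. rewrite <- sqrt_Rsqr_abs. apply sqrt_le_1_alt.
  rewrite Rsqr_pow2. assert (H := pow2_ge_0 (fst p - fst q)). lra.
Qed.

Lemma dist2_le_sum (p q : pt) :
  dist2 p q <= Rabs (fst p - fst q) + Rabs (snd p - snd q).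
Proof.
  unfold dist2.
  assert (H1 := Rabs_pos (fst p - fst q)). assert (H2 := Rabs_pos (snd p - snd q)).
  rewrite <- (sqrt_Rsqr (Rabs (fst p - fst q) + Rabs (snd p - snd q))) by lra.
  apply sqrt_le_1_alt. unfold Rsqr.
  assert (E1 := Rsqr_abs (fst p - fst q)). assert (E2 := Rsqr_abs (snd p - snd q)).
  unfold Rsqr in *. nra.
Qed.

Lemma dist2_scale (k : R) (p q p' q' : pt) :
  0 <= k -> fst p - fst q = k * (fst p' - fst q') ->
  snd p - snd q = k * (snd p' - snd q') -> dist2 p q = k * dist2 p' q'.
Proof.
  intros Hk E1 E2. unfold dist2. rewrite E1, E2.
  rewrite <- (sqrt_Rsqr k) at 3 by exact Hk.
  rewrite <- sqrt_mult_alt by apply Rle_0_sqr.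
  f_equal. unfold Rsqr. ring.
Qed.

Lemma dist2_sym (p q : pt) : dist2 p q = dist2 q p.
Proof. unfold dist2. f_equal. ring. Qed.

Lemma dist2_reflect (c p q : pt) : dist2 (reflect c p) (reflect c q) = dist2 p q.
Proof. unfold dist2, reflect; simpl. f_equal. ring. Qed.

Lemma dist2_comb_l (s t : R) (x y : pt) :
  dist2 (comb s x y) (comb t x y) = Rabs (s - t) * dist2 x y.
Proof.
  destruct (Rle_dec 0 (s - t)) as [H | H].
  - rewrite Rabs_right by lra. apply dist2_scale; [lra | simpl; ring | simpl; ring].
  - rewrite Rabs_left by lra. rewrite (dist2_sym x).
    apply dist2_scale; [lra | simpl; ring | simpl; ring].
Qed.

Lemma reflect_involutive (c x : pt) : reflect c (reflect c x) = x.
Proof. destruct x; unfold reflect; simpl; f_equal; ring. Qed.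

Lemma inside_rot (a b c o : pt) : inside a b c o -> inside b c a o.
Proof.
  intros [HD (r & s & t & Hr & Hs & Ht & E & ->)]. split.
  - unfold orient in *. intro H. apply HD. lra.
  - exists s, t, r. repeat split; try lra. f_equal; ring.
Qed.

Lemma inside_swap (a b c o : pt) : inside a b c o -> inside b a c o.
Proof.
  intros [HD (r & s & t & Hr & Hs & Ht & E & ->)]. split.
  - unfold orient in *. intro H. apply HD. lra.
  - exists s, r, t. repeat split; try lra. f_equal; ring.
Qed.

Lemma convex_inside (K : pset) (a b c o : pt) :
  convex K -> K a -> K b -> K c -> inside a b c o -> K o.
Proof.
  intros HK Ha Hb Hc [_ (r & s & t & Hr & Hs & Ht & E & ->)].
  replace (r * fst a + s * fst b + t * fst c, r * snd a + s * snd b + t * snd c)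
    with (comb (r + s) (comb (r / (r + s)) a b) c).
  - apply HK; [apply HK | |]; try assumption; [| lra].
    split; [apply Rlt_le, Rdiv_lt_0_compat; lra |].
    apply Rmult_le_reg_r with (r + s); [lra |]. field_simplify; lra.
  - replace t with (1 - r - s) by lra. unfold comb; simpl. f_equal; field; lra.
Qed.

(* The barycentric coordinates of [y] are [orient y b c / D], [orient a y c / D] and
   [orient a b y / D] with [D := orient a b c]; they are Lipschitz in [y]. *)
Lemma inside_open (a b c o : pt) :
  inside a b c o -> exists r, 0 < r /\ forall y, dist2 o y < r -> inside a b c y.
Proof.
  intros [HD (r & s & t & Hr & Hs & Ht & E & Ho)].
  set (D := orient a b c) in *.
  set (M := 1 + (Rabs (fst a) + Rabs (fst b) + Rabs (fst c)
             + Rabs (snd a) + Rabs (snd b) + Rabs (snd c))).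
  assert (HM : 0 < M).
  { unfold M. assert (H1 := Rabs_pos (fst a)). assert (H2 := Rabs_pos (fst b)).
    assert (H3 := Rabs_pos (fst c)). assert (H4 := Rabs_pos (snd a)).
    assert (H5 := Rabs_pos (snd b)). assert (H6 := Rabs_pos (snd c)). lra. }
  set (m := Rmin r (Rmin s t)).
  assert (Hm : 0 < m) by (unfold m; repeat apply Rmin_glb_lt; lra).
  assert (Hmr : m <= r) by apply Rmin_l.
  assert (Hms : m <= s) by (eapply Rle_trans; [apply Rmin_r | apply Rmin_l]).
  assert (Hmt : m <= t) by (eapply Rle_trans; [apply Rmin_r | apply Rmin_r]).
  assert (HD0 : 0 < Rabs D) by (apply Rabs_pos_lt; exact HD).
  (* Each weight is Lipschitz with constant [M / Rabs D], so a displacement below this radius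
     changes it by less than the least weight [m]. *)
  exists (m * Rabs D / M). split.
  { apply Rdiv_lt_0_compat; [nra | exact HM]. }
  intros y Hy.
  assert (Hd : dist2 o y * M < m * Rabs D).
  { apply Rmult_lt_reg_r with (/ M); [apply Rinv_0_lt_compat; exact HM |].
    rewrite Rmult_assoc, Rinv_r by lra. unfold Rdiv in Hy. lra. }
  assert (Hx := dist2_ge_fst o y). assert (Hz := dist2_ge_snd o y).
  set (d := dist2 o y) in *.
  assert (key : forall k p q, 0 < k -> m <= k ->
     (exists f g h i, p = f - g /\ q = h - i /\ Rabs f + Rabs g + Rabs h + Rabs i <= M) ->
     0 < k + ((fst y - fst o) * p + (snd y - snd o) * q) / D).
  { intros k p q Hk Hmk (f & g & h & i & -> & -> & Hle).
    assert (A : Rabs ((fst y - fst o) * (f - g) + (snd y - snd o) * (h - i)) <= d * M).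
    { eapply Rle_trans; [apply Rabs_triang |]. rewrite !Rabs_mult.
      rewrite (Rabs_minus_sym (fst y)), (Rabs_minus_sym (snd y)).
      assert (B1 : Rabs (f - g) <= Rabs f + Rabs g).
      { unfold Rminus. eapply Rle_trans; [apply Rabs_triang |]. rewrite Rabs_Ropp. lra. }
      assert (B2 : Rabs (h - i) <= Rabs h + Rabs i).
      { unfold Rminus. eapply Rle_trans; [apply Rabs_triang |]. rewrite Rabs_Ropp. lra. }
      assert (P1 := Rabs_pos (f - g)). assert (P2 := Rabs_pos (h - i)).
      assert (P3 := Rabs_pos (fst o - fst y)). assert (P4 := Rabs_pos (snd o - snd y)).
      nra. }
    set (w := (fst y - fst o) * (f - g) + (snd y - snd o) * (h - i)) in *.
    assert (B : Rabs (w / D) < k).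
    { unfold Rdiv. rewrite Rabs_mult, Rabs_inv.
      apply Rmult_lt_reg_r with (Rabs D); [exact HD0 |].
      rewrite Rmult_assoc, Rinv_l by lra. nra. }
    apply Rabs_def2 in B. lra. }
  assert (Ho1 : fst o = r * fst a + s * fst b + t * fst c) by (rewrite Ho; reflexivity).
  assert (Ho2 : snd o = r * snd a + s * snd b + t * snd c) by (rewrite Ho; reflexivity).
  assert (Hpos : forall z, 0 <= Rabs z) by (intro; apply Rabs_pos).
  assert (Pa := Hpos (fst a)). assert (Pb := Hpos (fst b)). assert (Pc := Hpos (fst c)).
  assert (Pa' := Hpos (snd a)). assert (Pb' := Hpos (snd b)). assert (Pc' := Hpos (snd c)).
  split; [exact HD |].
  exists (r + ((fst y - fst o) * (snd b - snd c) + (snd y - snd o) * (fst c - fst b)) / D),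
         (s + ((fst y - fst o) * (snd c - snd a) + (snd y - snd o) * (fst a - fst c)) / D),
         (t + ((fst y - fst o) * (snd a - snd b) + (snd y - snd o) * (fst b - fst a)) / D).
  do 3 (split; [apply key; [lra | lra |]; do 4 eexists;
                split; [reflexivity | split; [reflexivity | unfold M; lra]] |]).
  split.
  { transitivity (r + s + t); [field; exact HD | exact E]. }
  destruct y as [y1 y2]; cbn [fst snd] in *.
  replace r with (1 - s - t) in * by lra.
  rewrite Ho1, Ho2. unfold D, orient in *. f_equal; field; exact HD.
Qed.

Lemma inside_interior (K : pset) (a b c o : pt) :
  convex K -> K a -> K b -> K c -> inside a b c o -> interior K o.
Proof.
  intros HK Ha Hb Hc Hin. destruct (inside_open _ _ _ _ Hin) as (r & Hr & H).
  exists r. split; [exact Hr |]. intros y Hy.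
  exact (convex_inside K a b c y HK Ha Hb Hc (H y Hy)).
Qed.

(** The homothety with centre [x] and ratio [1 - t] carries the ball around [o] to a ball around the
    combination, and convexity keeps it in [K]. *)
Lemma interior_comb (K : pset) (t : R) (x o : pt) :
  convex K -> interior K o -> K x -> 0 <= t < 1 -> interior K (comb t x o).
Proof.
  intros HK (r & Hr & H) Hx Ht. exists ((1 - t) * r). split; [nra |].
  intros z Hz.
  set (o' := ((fst z - t * fst x) / (1 - t), (snd z - t * snd x) / (1 - t)) : pt).
  replace z with (comb t x o').
  - apply HK; [exact Hx | | lra]. apply H.
    rewrite (dist2_scale (1 - t) _ _ o o') in Hz.
    + apply Rmult_lt_reg_l with (1 - t); lra.
    + lra.
    + unfold o', comb; simpl. field. lra.
    + unfold o', comb; simpl. field. lra.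
  - destruct z as [z1 z2]. unfold o', comb; simpl. f_equal; field; lra.
Qed.

Lemma interior_not_boundary (K : pset) (x : pt) : interior K x -> ~ boundary K x.
Proof.
  intros (r & Hr & H) [_ Hc]. destruct (Hc r Hr) as (y & Hy & Hd).
  exact (Hy (H y Hd)).
Qed.

(** * The six-point condition and simple closed curves *)

Definition hereditarily_csc (G : pset) : Prop :=
  forall l : list pt, (length l <= 6)%nat -> (forall x, In x l -> G x) ->
    csc_position (fun x => In x l).

Lemma curve_coordinates (G : pset) :
  simple_closed_curve G ->
  exists x y : R -> R, continuity x /\ continuity y /\ x 0 = x 1 /\ y 0 = y 1 /\
    (forall s t, 0 <= s < 1 -> 0 <= t < 1 -> x s = x t -> y s = y t -> s = t) /\
    (forall t, G (x t, y t)) /\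
    (forall p, G p -> exists t, 0 <= t <= 1 /\ p = (x t, y t)).
Proof.
  intros (gamma & Hc & Hloop & Hinj & HG).
  (* Precomposing with the retraction of the line onto [0, 1] makes the coordinates continuous on
     all of [R]. *)
  set (clamp := fun t => Rmax 0 (Rmin 1 t)).
  assert (C1 : forall t, 0 <= clamp t <= 1).
  { intro t. unfold clamp, Rmax, Rmin. repeat destruct (Rle_dec _ _); lra. }
  assert (C2 : forall t, 0 <= t <= 1 -> clamp t = t).
  { intros t Ht. unfold clamp, Rmax, Rmin. repeat destruct (Rle_dec _ _); lra. }
  assert (C3 : forall s t, Rabs (clamp s - clamp t) <= Rabs (s - t)).
  { intros s t. unfold clamp, Rmax, Rmin, Rabs.
    repeat destruct (Rle_dec _ _); repeat destruct (Rcase_abs _); lra. }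
  assert (E : forall t, 0 <= t <= 1 -> gamma (clamp t) = gamma t)
    by (intros t Ht; rewrite C2; auto).
  exists (fun t => fst (gamma (clamp t))), (fun t => snd (gamma (clamp t))).
  assert (Hcont : forall t eps, 0 < eps -> exists d, 0 < d /\ forall s,
            Rabs (s - t) < d -> dist2 (gamma (clamp s)) (gamma (clamp t)) < eps).
  { intros t eps He. destruct (Hc (clamp t) (C1 t) eps He) as (d & Hd & H).
    exists d. split; [exact Hd |]. intros s Hs. apply H; [apply C1 |].
    specialize (C3 s t). lra. }
  split; [| split; [| split; [| split; [| split; [| split]]]]].
  - intros t eps He. destruct (Hcont t eps He) as (d & Hd & H).
    exists d. split; [exact Hd |]. intros s [_ Hs]. simpl in *. unfold Rdist in *.
    specialize (H s Hs). eapply Rle_lt_trans; [apply dist2_ge_fst | exact H].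
  - intros t eps He. destruct (Hcont t eps He) as (d & Hd & H).
    exists d. split; [exact Hd |]. intros s [_ Hs]. simpl in *. unfold Rdist in *.
    specialize (H s Hs). eapply Rle_lt_trans; [apply dist2_ge_snd | exact H].
  - rewrite !E by lra. now rewrite Hloop.
  - rewrite !E by lra. now rewrite Hloop.
  - intros s t Hs Ht. rewrite !E by lra. intros E1 E2. apply Hinj; auto.
    rewrite (surjective_pairing (gamma s)), (surjective_pairing (gamma t)). congruence.
  - intro t. rewrite <- surjective_pairing. apply HG. eauto.
  - intros p Hp. apply HG in Hp. destruct Hp as (t & Ht & <-). exists t. split; [exact Ht |].
    rewrite E by exact Ht. apply surjective_pairing.
Qed.

(** A circle does not embed in a line: the mean of [g 0] and [g (1/2)] is taken on both halves of
    the loop, by the intermediate value theorem. *)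
Lemma loop_collision (g : R -> R) :
  continuity g -> g 0 = g 1 -> exists s t, 0 <= s < t /\ t < 1 /\ g s = g t.
Proof.
  intros Hg Hloop.
  destruct (Req_dec (g 0) (g (1/2))) as [E | NE].
  { exists 0, (1/2). lra. }
  set (v := (g 0 + g (1/2)) / 2).
  assert (Hf : continuity (g - fct_cte v)%F).
  { apply continuity_minus; [exact Hg | apply continuity_const; now intros ? ?]. }
  destruct (IVT_cor _ 0 (1/2) Hf) as (s & Hs & Es); [lra | |].
  { unfold minus_fct, fct_cte, v. nra. }
  destruct (IVT_cor _ (1/2) 1 Hf) as (t & Ht & Et); [lra | |].
  { unfold minus_fct, fct_cte, v. nra. }
  unfold minus_fct, fct_cte, v in *.
  assert (s <> 1/2) by (intros ->; lra).
  assert (t <> 1) by (intros ->; lra).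
  exists s, t. lra.
Qed.

(** The curve is infinite: the parameters [/ (INR k + 2)] give pairwise distinct points, too many
    for [l]. *)
Lemma curve_avoids (G : pset) (l : list pt) :
  simple_closed_curve G -> exists p, G p /\ ~ In p l.
Proof.
  intros (gamma & _ & _ & Hinj & HG).
  set (f := fun k => gamma (/ (INR k + 2))).
  assert (Hr : forall k, 0 < / (INR k + 2) < 1).
  { intro k. assert (H := pos_INR k). split; [apply Rinv_0_lt_compat; lra |].
    rewrite <- Rinv_1. apply Rinv_lt_contravar; lra. }
  apply NNPP. intro Hno.
  assert (Hincl : incl (map f (seq 0 (S (length l)))) l).
  { intros p Hp. apply in_map_iff in Hp. destruct Hp as (k & <- & _).
    apply NNPP. intro Hk. apply Hno. exists (f k). split; [| exact Hk].
    apply HG. exists (/ (INR k + 2)). split; [specialize (Hr k); lra | reflexivity]. }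
  apply NoDup_incl_length in Hincl.
  - rewrite length_map, length_seq in Hincl. lia.
  - apply NoDup_map_NoDup_ForallPairs; [| apply seq_NoDup].
    intros j k _ _ Ejk. apply Hinj in Ejk; [| specialize (Hr j); lra | specialize (Hr k); lra].
    apply INR_eq. apply (f_equal Rinv) in Ejk. rewrite !Rinv_inv in Ejk. lra.
Qed.

(** Padding with fresh points reduces the condition on lists of at most six points, possibly
    repeated, to the one on six distinct points. *)
Lemma curve_extend (G : pset) (l : list pt) (n : nat) :
  simple_closed_curve G -> (forall x, In x l -> G x) -> (length l <= n)%nat ->
  exists l', length l' = n /\ NoDup l' /\ incl l l' /\ (forall x, In x l' -> G x).
Proof.
  intros HG Hl Hn.
  assert (dec : forall x y : pt, {x = y} + {x <> y}).
  { intros [x1 x2] [y1 y2]. destruct (Req_EM_T x1 y1); [destruct (Req_EM_T x2 y2) |].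
    - left; congruence.
    - right; congruence.
    - right; congruence. }
  set (l0 := nodup dec l).
  assert (H0 : (length l0 <= n)%nat).
  { assert (H := NoDup_incl_length (NoDup_nodup dec l) (l' := l)).
    assert (incl l0 l) by (intros x; apply nodup_In). specialize (H H0). unfold l0. lia. }
  assert (Hk : forall k, exists l', length l' = (length l0 + k)%nat /\
              NoDup l' /\ incl l l' /\ (forall x, In x l' -> G x)).
  { intro k. induction k as [| k IH].
    - exists l0. split; [lia |]. split; [apply NoDup_nodup |].
      split; intros x Hx; [now apply nodup_In |].
      apply Hl. now apply (nodup_In dec).
    - destruct IH as (l' & E & ND & I & HG'). destruct (curve_avoids G l' HG) as (p & Hp & Np).
      exists (p :: l'). simpl. split; [lia |]. split; [now constructor |].
      split; [now apply incl_tl |]. intros x [<- | Hx]; auto. }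
  destruct (Hk (n - length l0)%nat) as (l' & E & H).
  exists l'. split; [lia | exact H].
Qed.

(** The hypothesis on [y] says that it lies in the convex hull of the five points. If the
    combination were on [G], a body would have it and the five points on its boundary; but [o] is
    interior to that body and [y] belongs to it, so the combination is interior too. *)
Lemma free_comb (G : pset) (a b c g h o y : pt) (t : R) :
  hereditarily_csc G -> G a -> G b -> G c -> G g -> G h -> inside a b c o -> 0 <= t < 1 ->
  (forall K, convex K -> K a -> K b -> K c -> K g -> K h -> K y) ->
  ~ G (comb t y o).
Proof.
  intros H6 Ha Hb Hc Hg Hh Ho Ht Hy HGy.
  destruct (H6 (a :: b :: c :: g :: h :: comb t y o :: nil)) as (K & HK & _ & HbdK).
  - simpl; lia.
  - intros x Hx. simpl in Hx. intuition congruence.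
  - destruct HK as (Kconv & Kcl & _).
    assert (HK : forall x, In x (a :: b :: c :: g :: h :: comb t y o :: nil) -> K x)
      by (intros x Hx; apply Kcl; apply HbdK; exact Hx).
    apply (interior_not_boundary K (comb t y o)).
    + apply interior_comb; auto.
      * apply (inside_interior K a b c); auto; apply HK; simpl; auto.
      * apply Hy; auto; apply HK; simpl; auto 10.
    + apply HbdK. simpl; auto 10.
Qed.

(** * Rays from a point inside a triangle of curve points *)

Lemma inside_notin (G : pset) (a b c o : pt) :
  hereditarily_csc G -> G a -> G b -> G c -> inside a b c o -> ~ G o.
Proof.
  intros H6 Ha Hb Hc Ho. rewrite <- (comb_0 a o).
  apply (free_comb G a b c a a); auto; lra.
Qed.

(** Of two curve points on a ray, the nearer would be a combination of the farther and [o], which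
    [free_comb] forbids. *)
Lemma ray_unique (G : pset) (a b c o g : pt) (k : R) :
  hereditarily_csc G -> G a -> G b -> G c -> inside a b c o ->
  0 < k -> G g -> G (comb k g o) -> k = 1.
Proof.
  intros H6 Ha Hb Hc Ho Hk Hg Hkg.
  destruct (Rtotal_order k 1) as [H | [H | H]]; [| exact H |]; exfalso.
  - revert Hkg. apply (free_comb G a b c g g); auto; lra.
  - replace g with (comb (/ k) (comb k g o) o) in Hg.
    + revert Hg. apply (free_comb G a b c (comb k g o) (comb k g o)); auto.
      split; [apply Rlt_le, Rinv_0_lt_compat; lra |].
      rewrite <- Rinv_1. apply Rinv_lt_contravar; lra.
    + destruct g; unfold comb; simpl. f_equal; field; lra.
Qed.

(* If the ray from [o] through [w] missed the curve, the tangent of half the angle measured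
   from the opposite ray, [Y / (sqrt (X^2 + Y^2) + X)], would be a continuous injective
   function on a circle. *)
Lemma ray_meets (G : pset) (a b c o w : pt) :
  simple_closed_curve G -> hereditarily_csc G -> G a -> G b -> G c -> inside a b c o ->
  w <> o -> exists k, 0 < k /\ G (comb k w o).
Proof.
  intros HS H6 Ha Hb Hc Ho Hw. apply NNPP. intro Hno.
  destruct (curve_coordinates G HS) as (x & y & Cx & Cy & Lx & Ly & Inj & GG & _).
  set (p := fst w - fst o). set (q := snd w - snd o).
  (* Up to the factor [|w - o|], [X] and [Y] are the coordinates of the curve point seen from [o],
     along the opposite ray and perpendicular to it. *)
  set (X := fun t => - (p * (x t - fst o) + q * (y t - snd o))).
  set (Y := fun t => p * (y t - snd o) - q * (x t - fst o)).
  set (N := fun t => sqrt (X t * X t + Y t * Y t)).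
  assert (Hpq : 0 < p * p + q * q).
  { assert (p <> 0 \/ q <> 0) as [H | H].
    { apply NNPP. intro H. apply Hw. destruct w, o. unfold p, q in H; simpl in H.
      f_equal; apply NNPP; intro; apply H; [left | right]; lra. }
    - assert (0 < p * p) by (apply Rsqr_pos_lt; exact H). nra.
    - assert (0 < q * q) by (apply Rsqr_pos_lt; exact H). nra. }
  assert (HN : forall t, N t * N t = X t * X t + Y t * Y t)
    by (intro t; apply sqrt_sqrt; nra).
  assert (HN0 : forall t, 0 <= N t) by (intro t; apply sqrt_pos).
  assert (Px : forall t, (p * p + q * q) * (x t - fst o) = - p * X t - q * Y t)
    by (intro t; unfold X, Y; ring).
  assert (Py : forall t, (p * p + q * q) * (y t - snd o) = - q * X t + p * Y t)
    by (intro t; unfold X, Y; ring).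
  (* Otherwise [Y t = 0] and [X t <= 0]: the curve point is [o] itself or lies on the missed ray. *)
  assert (Hpos : forall t, 0 < N t + X t).
  { intro t. apply Rnot_le_lt. intro Hle.
    assert (EY : Y t = 0) by (specialize (HN t); specialize (HN0 t); nra).
    assert (HX : X t <= 0) by (specialize (HN0 t); lra).
    specialize (Px t). specialize (Py t). specialize (GG t). rewrite EY in Px, Py.
    destruct HX as [HX | HX].
    - apply Hno. exists (- X t / (p * p + q * q)). split; [apply Rdiv_lt_0_compat; lra |].
      replace (comb _ w o) with (x t, y t); [exact GG |].
      unfold comb. f_equal.
      + apply Rmult_eq_reg_l with (p * p + q * q); [| lra].
        unfold p, q in *. field_simplify; [| lra]. lra.
      + apply Rmult_eq_reg_l with (p * p + q * q); [| lra].
        unfold p, q in *. field_simplify; [| lra]. lra.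
    - apply (inside_notin G a b c o); auto.
      replace o with (x t, y t); [exact GG |].
      rewrite HX in Px, Py. rewrite (surjective_pairing o). f_equal; nra. }
  assert (CX : continuity X) by (unfold X; reg).
  assert (CY : continuity Y) by (unfold Y; reg).
  assert (CN : continuity N).
  { intro t. apply (continuity_pt_comp (fun t => X t * X t + Y t * Y t) sqrt).
    - revert t. change (continuity (X * X + Y * Y)%F). reg.
    - apply continuity_pt_sqrt. nra. }
  destruct (loop_collision (Y / (N + X))%F) as (s & t & Hs & Ht & E).
  - apply continuity_div; [exact CY | now apply continuity_plus |].
    intro t. unfold plus_fct. specialize (Hpos t). lra.
  - unfold div_fct, plus_fct, N, X, Y. now rewrite Lx, Ly.
  - unfold div_fct, plus_fct in E.
    set (T := Y s / (N s + X s)) in *.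
    (* The half-angle formulas: [T] determines [X] and [Y] up to a positive factor, so the two
       colliding points lie on one ray from [o]. *)
    assert (Hfac : forall r, Y r / (N r + X r) = T ->
              2 * X r = (1 - T * T) * (N r + X r) /\ Y r = T * (N r + X r)).
    { intros r Er. specialize (Hpos r). specialize (HN r).
      assert (EY : Y r = T * (N r + X r)) by (rewrite <- Er; field; lra).
      split; [| exact EY].
      apply Rmult_eq_reg_l with (N r + X r); [| lra].
      transitivity ((N r + X r) * (N r + X r) - Y r * Y r); [nra |]. rewrite EY. ring. }
    destruct (Hfac s eq_refl) as [Xs Ys]. destruct (Hfac t (eq_sym E)) as [Xt Yt].
    set (k := (N t + X t) / (N s + X s)).
    assert (Hs0 := Hpos s). assert (Ht0 := Hpos t).
    assert (Hk : 0 < k) by (apply Rdiv_lt_0_compat; lra).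
    assert (Ek : N t + X t = k * (N s + X s)) by (unfold k; field; lra).
    assert (EX : X t = k * X s) by (rewrite Ek in Xt; nra).
    assert (EY : Y t = k * Y s) by (rewrite Ek in Yt; nra).
    assert (Est : (x t, y t) = comb k (x s, y s) o).
    { unfold comb; simpl.
      assert (Ax := Px s). assert (Ay := Py s). assert (Bx := Px t). assert (By := Py t).
      rewrite EX, EY in Bx, By.
      f_equal; apply Rmult_eq_reg_l with (p * p + q * q); nra. }
    assert (k = 1).
    { apply (ray_unique G a b c o (x s, y s)); auto. rewrite <- Est. apply GG. }
    subst k. rewrite H, comb_1 in Est. injection Est as E1 E2.
    assert (s = t) by (apply Inj; auto; lra). lra.
Qed.

(** * The star hull: convexity, closedness and boundary *)

Definition star_hull (G : pset) (o : pt) : pset :=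
  fun x => exists g t, G g /\ 0 <= t <= 1 /\ x = comb t g o.

Lemma star_hull_incl (G : pset) (o x : pt) : G x -> star_hull G o x.
Proof. intro Hx. exists x, 1. rewrite comb_1. repeat split; auto; lra. Qed.

Lemma star_hull_of_outer (G : pset) (o x : pt) (k : R) :
  1 <= k -> G (comb k x o) -> star_hull G o x.
Proof.
  intros Hk HG. exists (comb k x o), (/ k). split; [exact HG |]. split.
  - split; [apply Rlt_le, Rinv_0_lt_compat; lra |].
    rewrite <- Rinv_1. apply Rinv_le_contravar; lra.
  - destruct x; unfold comb; simpl; f_equal; field; lra.
Qed.

(** The ray through the combination meets [G]. If it did so strictly before the combination, that
    curve point would lie on a segment from [o] to a point of the chord [g h], short of its end,
    against [free_comb]. *)
Lemma star_hull_convex (G : pset) (a b c o : pt) :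
  simple_closed_curve G -> hereditarily_csc G -> G a -> G b -> G c -> inside a b c o ->
  convex (star_hull G o).
Proof.
  intros HS H6 Ha Hb Hc Ho x y l (g & t & Hg & Ht & ->) (h & s & Hh & Hs & ->) Hl.
  destruct (classic (comb l (comb t g o) (comb s h o) = o)) as [E | NE].
  { rewrite E. exists a, 0. repeat split; try lra; auto. now rewrite comb_0. }
  destruct (ray_meets G a b c o _ HS H6 Ha Hb Hc Ho NE) as (k & Hk & Hw).
  destruct (Rle_lt_dec 1 k) as [H1 | H1]; [now apply (star_hull_of_outer G o _ k) |].
  (* [m] is the total weight of [g - o] and [h - o] in the combination seen from [o]; dividing by it
     gives the point of the chord [g h] in the same direction. *)
  exfalso. set (m := l * t + (1 - l) * s).
  assert (Hm : 0 < m).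
  { apply Rnot_le_lt. intro H. apply NE.
    assert (P1 : 0 <= l * t) by nra. assert (P2 : 0 <= (1 - l) * s) by nra. unfold m in H.
    assert (Z1 : l * t = 0) by lra. assert (Z2 : (1 - l) * s = 0) by lra.
    destruct o as [o1 o2], g as [g1 g2], h as [h1 h2]; unfold comb; simpl; f_equal.
    - transitivity (o1 + l * t * (g1 - o1) + (1 - l) * s * (h1 - o1)); [ring |].
      rewrite Z1, Z2. ring.
    - transitivity (o2 + l * t * (g2 - o2) + (1 - l) * s * (h2 - o2)); [ring |].
      rewrite Z1, Z2. ring. }
  assert (Hm1 : m <= 1) by (unfold m; nra).
  assert (Hq : 0 <= l * t / m <= 1).
  { split; [apply Rmult_le_pos; [nra | apply Rlt_le, Rinv_0_lt_compat; exact Hm] |].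
    apply Rmult_le_reg_r with m; [exact Hm |]. field_simplify; [| lra]. unfold m; nra. }
  revert Hw.
  replace (comb k (comb l (comb t g o) (comb s h o)) o)
    with (comb (k * m) (comb (l * t / m) g h) o).
  - apply (free_comb G a b c g h); auto. nra.
  - unfold comb; simpl. f_equal; field_simplify; try lra; unfold m; field.
Qed.

Lemma star_hull_outer (G : pset) (a b c o g : pt) (t : R) :
  hereditarily_csc G -> G a -> G b -> G c -> inside a b c o ->
  G g -> 1 < t -> ~ star_hull G o (comb t g o).
Proof.
  intros H6 Ha Hb Hc Ho Hg Ht (h & s & Hh & Hs & E).
  assert (Eg : g = comb (s / t) h o).
  { unfold comb in E. injection E as E1 E2. destruct g as [g1 g2]; unfold comb; simpl in *.
    f_equal; apply Rmult_eq_reg_l with t; try lra; field_simplify; lra. }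
  rewrite Eg in Hg. revert Hg. apply (free_comb G a b c h h); auto.
  split; [apply Rmult_le_pos; [lra | apply Rlt_le, Rinv_0_lt_compat; lra] |].
  apply Rmult_lt_reg_r with t; [lra |]. field_simplify; lra.
Qed.

(* If [y] in the star hull is close to a point [x] beyond [g = comb k x o], then [g] is a
   combination of [y] and a point close to [o], hence too deep to lie on [G]. *)
Lemma star_hull_closed (G : pset) (a b c o : pt) :
  simple_closed_curve G -> hereditarily_csc G -> G a -> G b -> G c -> inside a b c o ->
  is_closed (star_hull G o).
Proof.
  intros HS H6 Ha Hb Hc Ho x Hx.
  destruct (classic (x = o)) as [-> | NE].
  { exists a, 0. repeat split; try lra; auto. now rewrite comb_0. }
  destruct (ray_meets G a b c o x HS H6 Ha Hb Hc Ho NE) as (k & Hk & Hg).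
  destruct (Rle_lt_dec 1 k) as [H1 | H1]; [now apply (star_hull_of_outer G o _ k) |].
  exfalso. destruct (inside_open _ _ _ _ Ho) as (r & Hr & Hin).
  destruct (Hx (r * (1 - k) / k)) as (y & (g' & t & Hg' & Ht & Ey) & Hd).
  { apply Rdiv_lt_0_compat; nra. }
  (* [o'] solves [comb k y o' = comb k x o]; the distance from [y] to [x] was chosen to keep it
     within [r] of [o]. *)
  set (o' := (fst o + k / (1 - k) * (fst x - fst y),
              snd o + k / (1 - k) * (snd x - snd y)) : pt).
  assert (Ho' : inside a b c o').
  { apply Hin. rewrite dist2_sym, (dist2_scale (k / (1 - k)) _ _ x y).
    - apply Rmult_lt_reg_l with ((1 - k) / k); [apply Rdiv_lt_0_compat; lra |].
      replace ((1 - k) / k * (k / (1 - k) * dist2 x y)) with (dist2 x y) by (field; lra).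
      replace ((1 - k) / k * r) with (r * (1 - k) / k) by (field; lra). exact Hd.
    - apply Rlt_le, Rdiv_lt_0_compat; lra.
    - unfold o'; simpl; ring.
    - unfold o'; simpl; ring. }
  revert Hg. replace (comb k x o) with (comb k y o').
  - apply (free_comb G a b c g' g'); auto; [lra |].
    intros K HK Ka Kb Kc Kg' _. rewrite Ey. apply HK; auto.
    now apply (convex_inside K a b c).
  - unfold o', comb; simpl. f_equal; field; lra.
Qed.

Lemma star_hull_interior (G : pset) (a b c o g : pt) (t : R) :
  simple_closed_curve G -> hereditarily_csc G -> G a -> G b -> G c -> inside a b c o ->
  G g -> 0 <= t < 1 -> interior (star_hull G o) (comb t g o).
Proof.
  intros HS H6 Ha Hb Hc Ho Hg Ht.
  assert (HG : forall x, G x -> star_hull G o x) by (intro; apply star_hull_incl).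
  assert (HC := star_hull_convex G a b c o HS H6 Ha Hb Hc Ho).
  apply interior_comb; auto.
  apply (inside_interior _ a b c); auto.
Qed.

Lemma star_hull_boundary (G : pset) (a b c o x : pt) :
  simple_closed_curve G -> hereditarily_csc G -> G a -> G b -> G c -> inside a b c o ->
  boundary (star_hull G o) x <-> G x.
Proof.
  intros HS H6 Ha Hb Hc Ho. split.
  - intro Hbd.
    destruct (star_hull_closed G a b c o HS H6 Ha Hb Hc Ho x (proj1 Hbd)) as (g & t & Hg & Ht & ->).
    destruct (Req_dec t 1) as [-> | Ht1]; [now rewrite comb_1 |].
    exfalso. revert Hbd. apply interior_not_boundary.
    apply (star_hull_interior G a b c o); auto. lra.
  - intro Hx. split.
    + intros r Hr. exists x. rewrite dist2_refl. split; [| exact Hr].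
      now apply star_hull_incl.
    + intros r Hr. set (d := dist2 x o).
      assert (Hd : 0 <= d) by apply sqrt_pos.
      assert (He : 0 < r / (d + 1)) by (apply Rdiv_lt_0_compat; lra).
      (* A point just beyond [x] on its ray is outside the hull. The denominator [d + 1] keeps the
         displacement below [r] and avoids dividing by zero. *)
      exists (comb (1 + r / (d + 1)) x o). split.
      * apply (star_hull_outer G a b c o); auto. lra.
      * rewrite <- (comb_1 x o) at 1. rewrite dist2_comb_l. fold d.
        rewrite Rabs_left by lra.
        replace (- (1 - (1 + r / (d + 1))) * d) with (r - r / (d + 1)) by (field; lra). lra.
Qed.

(** * Extrema on the curve, and three noncollinear points *)

Lemma curve_attains_max (G : pset) (F : pt -> R) :
  simple_closed_curve G ->
  (forall x y, continuity x -> continuity y -> continuity (fun t => F (x t, y t))) ->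
  exists m, G m /\ forall g, G g -> F g <= F m.
Proof.
  intros HS HF.
  destruct (curve_coordinates G HS) as (x & y & Cx & Cy & _ & _ & _ & GG & HG).
  destruct (continuity_ab_maj (fun t => F (x t, y t)) 0 1) as (t & Ht & H).
  - lra.
  - intros t _. now apply HF.
  - exists (x t, y t). split; [apply GG |].
    intros g Hg. apply HG in Hg. destruct Hg as (s & Hs & ->). auto.
Qed.

(** For such [m], [dot u m] is the value at [u] of the support function of [G]. *)
Definition maximizer (G : pset) (u m : pt) : Prop :=
  G m /\ forall g, G g -> dot u g <= dot u m.

Lemma maximizer_exists (G : pset) (u : pt) :
  simple_closed_curve G -> exists m, maximizer G u m.
Proof.
  intro HS. apply curve_attains_max; [exact HS |].
  intros x y Cx Cy. unfold dot; simpl. reg.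
Qed.

Lemma star_hull_bounded (G : pset) (o : pt) :
  simple_closed_curve G -> is_bounded (star_hull G o).
Proof.
  intro HS.
  destruct (curve_attains_max G (fun g => dist2 (0, 0) g) HS) as (m & Hm & Hmax).
  { intros x y Cx Cy t. unfold dist2; simpl.
    apply (continuity_pt_comp (fun t => (0 - x t) * ((0 - x t) * 1)
             + (0 - y t) * ((0 - y t) * 1)) sqrt).
    - revert t. change (continuity ((fct_cte 0 - x) * ((fct_cte 0 - x) * fct_cte 1)
        + (fct_cte 0 - y) * ((fct_cte 0 - y) * fct_cte 1))%F). reg.
    - apply continuity_pt_sqrt. nra. }
  exists (2 * dist2 (0, 0) m + Rabs (fst o) + Rabs (snd o)).
  intros x (g & t & Hg & Ht & ->). specialize (Hmax g Hg). simpl in Hmax.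
  assert (A1 := dist2_ge_fst (0, 0) g). assert (A2 := dist2_ge_snd (0, 0) g).
  eapply Rle_trans; [apply dist2_le_sum |]. unfold comb; simpl in *.
  rewrite !Rminus_0_l, Rabs_Ropp in *.
  assert (P1 := Rabs_pos (fst g)). assert (P2 := Rabs_pos (snd g)).
  assert (P3 := Rabs_pos (fst o)). assert (P4 := Rabs_pos (snd o)).
  assert (B1 := Rabs_triang (t * fst g) ((1 - t) * fst o)).
  assert (B2 := Rabs_triang (t * snd g) ((1 - t) * snd o)).
  rewrite !Rabs_mult, (Rabs_right t), (Rabs_right (1 - t)) in B1, B2 by lra.
  rewrite !Rabs_Ropp in *. nra.
Qed.

(** If the curve lay on a line, the projection to the direction [(p, q)] of that line would be
    injective on it, against [loop_collision]. *)
Lemma noncollinear (G : pset) :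
  simple_closed_curve G -> exists a b c, G a /\ G b /\ G c /\ orient a b c <> 0.
Proof.
  intro HS. apply NNPP. intro Hno.
  destruct (curve_coordinates G HS) as (x & y & Cx & Cy & Lx & Ly & Inj & GG & _).
  set (p := x (1/2) - x 0). set (q := y (1/2) - y 0).
  assert (Hz : forall t, p * (y t - y 0) - q * (x t - x 0) = 0).
  { intro t. apply NNPP. intro H. apply Hno.
    exists (x 0, y 0), (x (1/2), y (1/2)), (x t, y t). repeat split; auto. }
  assert (Hpq : 0 < p * p + q * q).
  { apply Rnot_le_lt. intro H.
    assert (P1 := Rle_0_sqr p). assert (P2 := Rle_0_sqr q). unfold Rsqr in P1, P2.
    assert (p = 0) by (apply Rsqr_0_uniq; unfold Rsqr; lra).
    assert (q = 0) by (apply Rsqr_0_uniq; unfold Rsqr; lra).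
    assert (0 = 1/2); [apply Inj; unfold p, q in *; lra | lra]. }
  destruct (loop_collision (fun t => p * x t + q * y t)) as (s & t & Hs & Ht & E).
  - reg.
  - now rewrite Lx, Ly.
  - assert (s = t); [| lra].
    assert (Hzs := Hz s). assert (Hzt := Hz t).
    assert (A : p * (x s - x t) + q * (y s - y t) = 0) by lra.
    assert (B : p * (y s - y t) - q * (x s - x t) = 0) by lra.
    apply Inj; try lra; apply Rmult_eq_reg_l with (p * p + q * q); try lra;
      apply Rminus_diag_uniq.
    + transitivity (p * (p * (x s - x t) + q * (y s - y t))
                    - q * (p * (y s - y t) - q * (x s - x t))); [ring | rewrite A, B; ring].
    + transitivity (q * (p * (x s - x t) + q * (y s - y t))
                    + p * (p * (y s - y t) - q * (x s - x t))); [ring | rewrite A, B; ring].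
Qed.

(** * Barycentric coordinates and the six-point obstruction *)

Lemma centroid_inside (a b c : pt) :
  orient a b c <> 0 ->
  inside a b c ((fst a + fst b + fst c) / 3, (snd a + snd b + snd c) / 3).
Proof.
  intro H. split; [exact H |]. exists (/3), (/3), (/3). repeat split; try lra.
  f_equal; field.
Qed.

(* Seen from [o], the reflection [z] of [a] is [- (1 + 2 s) a - 2 t b], so that [- k a] is a
   positive multiple of a point of the segment from [z] to [b]; as [t <= s], the factor is at
   most [k < 1]. *)
Lemma opposite_interior (K : pset) (a b c o e : pt) (s t k : R) :
  convex K -> symmetric_about e K -> K a -> K b -> K c -> inside a b c o ->
  0 <= t <= s -> 0 < k < 1 ->
  e = (fst o - s * (fst a - fst o) - t * (fst b - fst o),
       snd o - s * (snd a - snd o) - t * (snd b - snd o)) ->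
  interior K (comb (- k) a o).
Proof.
  intros HK Hsym Ha Hb Hc Ho Hst Hk He.
  assert (Hi := inside_interior K a b c o HK Ha Hb Hc Ho).
  replace (comb (- k) a o)
    with (comb (k * (1 + 2 * t) / (1 + 2 * s)) (comb (/ (1 + 2 * t)) (reflect e a) b) o).
  - apply interior_comb; auto.
    + apply HK; auto. split; [apply Rlt_le, Rinv_0_lt_compat; lra |].
      rewrite <- Rinv_1. apply Rinv_le_contravar; lra.
    + split.
      * apply Rmult_le_pos; [nra | apply Rlt_le, Rinv_0_lt_compat; lra].
      * apply Rmult_lt_reg_r with (1 + 2 * s); [lra |]. field_simplify; nra.
  - rewrite He. unfold comb, reflect; simpl. f_equal; field; lra.
Qed.

Lemma barycentric (a b c e : pt) :
  orient a b c <> 0 -> exists l m n, l + m + n = 1 /\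
    e = (l * fst a + m * fst b + n * fst c, l * snd a + m * snd b + n * snd c).
Proof.
  intro H. exists (orient e b c / orient a b c), (orient a e c / orient a b c),
                  (orient a b e / orient a b c).
  split.
  - unfold orient in *. field. exact H.
  - destruct e; unfold orient in *; simpl in *. f_equal; field; exact H.
Qed.

(** The relation [r (a - o) + s (b - o) + t (c - o) = 0] eliminates [c - o] from [e - o]; the two
    inequalities say that the remaining coefficients are nonpositive. *)
Lemma cone_coordinates (a b c o e : pt) (r s t l m n : R) :
  0 < t -> r + s + t = 1 -> l + m + n = 1 ->
  o = (r * fst a + s * fst b + t * fst c, r * snd a + s * snd b + t * snd c) ->
  e = (l * fst a + m * fst b + n * fst c, l * snd a + m * snd b + n * snd c) ->
  l * t <= n * r -> m * t <= n * s ->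
  exists x y, 0 <= x /\ 0 <= y /\
    e = (fst o - x * (fst a - fst o) - y * (fst b - fst o),
         snd o - x * (snd a - snd o) - y * (snd b - snd o)).
Proof.
  intros Ht E1 E2 Ho He H1 H2. exists ((n * r - l * t) / t), ((n * s - m * t) / t).
  split; [apply Rmult_le_pos; [lra | apply Rlt_le, Rinv_0_lt_compat; lra] |].
  split; [apply Rmult_le_pos; [lra | apply Rlt_le, Rinv_0_lt_compat; lra] |].
  replace l with (1 - m - n) in * by lra. replace r with (1 - s - t) in * by lra.
  rewrite Ho, He; simpl. f_equal; field; lra.
Qed.

(** The cone containing [e] is the one opposite the vertex with the largest ratio among [l / r],
    [m / s], [n / t] of the weights of [e] and [o]. The predicate [P] lets data attached to the
    vertices follow their permutation. *)
Lemma negative_cones_cover (P : pt -> Prop) (a b c o e : pt) :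
  P a -> P b -> P c -> inside a b c o ->
  exists p q r s t, P p /\ P q /\ P r /\ inside p q r o /\ 0 <= t <= s /\
    e = (fst o - s * (fst p - fst o) - t * (fst q - fst o),
         snd o - s * (snd p - snd o) - t * (snd q - snd o)).
Proof.
  intros Pa Pb Pc Ho.
  assert (cone : exists p q r s t, P p /\ P q /\ P r /\ inside p q r o /\ 0 <= s /\ 0 <= t /\
    e = (fst o - s * (fst p - fst o) - t * (fst q - fst o),
         snd o - s * (snd p - snd o) - t * (snd q - snd o))).
  { assert (Hbca := inside_rot _ _ _ _ Ho). assert (Hcab := inside_rot _ _ _ _ Hbca).
    assert (Habc := Ho). destruct Ho as [HD (r & s & t & Hr & Hs & Ht & E & Ho)].
    destruct (barycentric a b c e HD) as (l & m & n & E' & He).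
    destruct (Rle_lt_dec (l * t) (n * r)) as [H1 | H1];
      [destruct (Rle_lt_dec (m * t) (n * s)) as [H2 | H2] |].
    - destruct (cone_coordinates a b c o e r s t l m n) as (x & y & H); auto.
      exists a, b, c, x, y. tauto.
    - destruct (cone_coordinates c a b o e t r s n l m) as (x & y & H); auto; try lra.
      + rewrite Ho. f_equal; ring.
      + rewrite He. f_equal; ring.
      + apply Rmult_le_reg_r with t; [exact Ht |]. nra.
      + exists c, a, b, x, y. tauto.
    - destruct (Rle_lt_dec (m * r) (l * s)) as [H2 | H2].
      + destruct (cone_coordinates b c a o e s t r m n l) as (x & y & H); auto; try lra.
        * rewrite Ho. f_equal; ring.
        * rewrite He. f_equal; ring.
        * exists b, c, a, x, y. tauto.
      + destruct (cone_coordinates c a b o e t r s n l m) as (x & y & H); auto; try lra.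
        * rewrite Ho. f_equal; ring.
        * rewrite He. f_equal; ring.
        * apply Rmult_le_reg_r with r; [exact Hr |]. nra.
        * exists c, a, b, x, y. tauto. }
  destruct cone as (p & q & r & s & t & Pp & Pq & Pr & Hin & Hs & Ht & E).
  destruct (Rle_lt_dec t s) as [H | H].
  - exists p, q, r, s, t. auto 10.
  - exists q, p, r, t, s. apply inside_swap in Hin.
    do 4 (split; [assumption |]). split; [lra |]. rewrite E. f_equal; ring.
Qed.

Lemma no_short_opposites (G : pset) (a b c o : pt) (ka kb kc : R) :
  hereditarily_csc G -> G a -> G b -> G c -> inside a b c o ->
  0 < ka < 1 -> 0 < kb < 1 -> 0 < kc < 1 ->
  G (comb (- ka) a o) -> G (comb (- kb) b o) -> G (comb (- kc) c o) -> False.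
Proof.
  intros H6 Ha Hb Hc Ho Hka Hkb Hkc Ga Gb Gc.
  destruct (H6 (a :: b :: c :: comb (- ka) a o :: comb (- kb) b o :: comb (- kc) c o :: nil))
    as (K & HK & [e He] & Hbd).
  - simpl; lia.
  - intros x Hx. simpl in Hx. intuition congruence.
  - assert (Kcl : is_closed K) by apply HK.
    assert (Kconv : convex K) by apply HK.
    (* Each vertex carries its own opposite boundary point, so the one belonging to [p] is available
       whichever vertex [p] is. *)
    destruct (negative_cones_cover
      (fun x => K x /\ exists k, 0 < k < 1 /\ boundary K (comb (- k) x o)) a b c o e)
      as (p & q & r & s & t & (Kp & k & Hk & Hb') & (Kq & _) & (Kr & _) & Hin & Hst & E).
    + split; [apply Kcl, Hbd; simpl; auto | exists ka; split; auto; apply Hbd; simpl; auto 10].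
    + split; [apply Kcl, Hbd; simpl; auto | exists kb; split; auto; apply Hbd; simpl; auto 10].
    + split; [apply Kcl, Hbd; simpl; auto | exists kc; split; auto; apply Hbd; simpl; auto 10].
    + exact Ho.
    + revert Hb'. apply interior_not_boundary.
      now apply (opposite_interior K p q r o e s t).
Qed.

(** * Three wide directions and the centre of the bounding box *)

Lemma dominant_minor_pos (m11 m12 m13 m21 m22 m23 m31 m32 m33 : R) :
  m11 + m21 + m31 = 0 -> m12 + m22 + m32 = 0 -> m13 + m23 + m33 = 0 ->
  - m11 < m12 <= m11 -> - m11 < m13 -> - m22 < m21 <= m22 -> - m22 < m23 ->
  - m33 < m31 -> - m33 < m32 ->
  0 < m11 * m22 - m12 * m21.
Proof.
  intros C1 C2 C3 H12 H13 H21 H23 H31 H32.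
  (* Twice the minor is [(m11 - m12) (m22 + m21) + (m11 + m12) (m22 - m21)]. If both differences
     vanish, the column sums turn the bounds on [m13] and [m23] into [m33 < m11 + m22], and the one
     on [m31] into the reverse. *)
  destruct (Req_dec m12 m11) as [E1 | N1].
  - destruct (Req_dec m21 m22) as [E2 | N2]; [exfalso; lra |].
    rewrite E1. assert (0 < m11 * (m22 - m21)) by (apply Rmult_lt_0_compat; lra). lra.
  - assert (0 < (m11 - m12) * (m22 + m21)) by (apply Rmult_lt_0_compat; lra).
    assert (0 <= (m11 + m12) * (m22 - m21)) by (apply Rmult_le_pos; lra).
    lra.
Qed.

(* In the matrix [dot u_i (a_j - o)] the diagonal dominates each row and the columns sum to 0;
   its minors are the products of the cross products of the [u_i] and of the [a_j - o]. *)
Lemma inside_maximizers (G : pset) (u1 u2 u3 a1 a2 a3 o : pt) :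
  fst u1 + fst u2 + fst u3 = 0 -> snd u1 + snd u2 + snd u3 = 0 ->
  maximizer G u1 a1 -> maximizer G u2 a2 -> maximizer G u3 a3 ->
  (forall g, G g -> 2 * dot u1 o < dot u1 a1 + dot u1 g) ->
  (forall g, G g -> 2 * dot u2 o < dot u2 a2 + dot u2 g) ->
  (forall g, G g -> 2 * dot u3 o < dot u3 a3 + dot u3 g) ->
  inside a1 a2 a3 o.
Proof.
  intros E1 E2 [G1 M1] [G2 M2] [G3 M3] D1 D2 D3.
  set (m := fun u a : pt => dot u a - dot u o).
  assert (S : forall a, m u1 a + m u2 a + m u3 a = 0).
  { intro a. unfold m, dot.
    replace (fst u3) with (- fst u1 - fst u2) by lra.
    replace (snd u3) with (- snd u1 - snd u2) by lra. ring. }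
  assert (B1 : forall g, G g -> - m u1 a1 < m u1 g <= m u1 a1)
    by (intros g Hg; specialize (M1 g Hg); specialize (D1 g Hg); unfold m; lra).
  assert (B2 : forall g, G g -> - m u2 a2 < m u2 g <= m u2 a2)
    by (intros g Hg; specialize (M2 g Hg); specialize (D2 g Hg); unfold m; lra).
  assert (B3 : forall g, G g -> - m u3 a3 < m u3 g <= m u3 a3)
    by (intros g Hg; specialize (M3 g Hg); specialize (D3 g Hg); unfold m; lra).
  assert (P12 := dominant_minor_pos (m u1 a1) (m u1 a2) (m u1 a3) (m u2 a1) (m u2 a2) (m u2 a3)
                   (m u3 a1) (m u3 a2) (m u3 a3)).
  assert (P23 := dominant_minor_pos (m u2 a2) (m u2 a3) (m u2 a1) (m u3 a2) (m u3 a3) (m u3 a1)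
                   (m u1 a2) (m u1 a3) (m u1 a1)).
  assert (P31 := dominant_minor_pos (m u3 a3) (m u3 a1) (m u3 a2) (m u1 a3) (m u1 a1) (m u1 a2)
                   (m u2 a3) (m u2 a1) (m u2 a2)).
  assert (S1 := S a1). assert (S2 := S a2). assert (S3 := S a3).
  assert (B12 := B1 _ G2). assert (B13 := B1 _ G3). assert (B21 := B2 _ G1).
  assert (B23 := B2 _ G3). assert (B31 := B3 _ G1). assert (B32 := B3 _ G2).
  specialize (P12 ltac:(lra) ltac:(lra) ltac:(lra) ltac:(lra) ltac:(lra) ltac:(lra) ltac:(lra)
    ltac:(lra) ltac:(lra)).
  specialize (P23 ltac:(lra) ltac:(lra) ltac:(lra) ltac:(lra) ltac:(lra) ltac:(lra) ltac:(lra)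
    ltac:(lra) ltac:(lra)).
  specialize (P31 ltac:(lra) ltac:(lra) ltac:(lra) ltac:(lra) ltac:(lra) ltac:(lra) ltac:(lra)
    ltac:(lra) ltac:(lra)).
  (* As the [u_i] sum to zero, their cyclic cross products all equal [k], so the three areas at [o]
     share the sign of [k]. *)
  set (k := fst u1 * snd u2 - snd u1 * fst u2).
  assert (F12 : k * orient o a1 a2 = m u1 a1 * m u2 a2 - m u1 a2 * m u2 a1)
    by (unfold k, orient, m, dot; ring).
  assert (F23 : k * orient o a2 a3 = m u2 a2 * m u3 a3 - m u2 a3 * m u3 a2).
  { unfold k, orient, m, dot. replace (fst u3) with (- fst u1 - fst u2) by lra.
    replace (snd u3) with (- snd u1 - snd u2) by lra. ring. }
  assert (F31 : k * orient o a3 a1 = m u3 a3 * m u1 a1 - m u3 a1 * m u1 a3).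
  { unfold k, orient, m, dot. replace (fst u3) with (- fst u1 - fst u2) by lra.
    replace (snd u3) with (- snd u1 - snd u2) by lra. ring. }
  rewrite <- F12 in P12. rewrite <- F23 in P23. rewrite <- F31 in P31.
  assert (T : orient a1 a2 a3 = orient o a1 a2 + orient o a2 a3 + orient o a3 a1)
    by (unfold orient; ring).
  assert (PT : 0 < k * orient a1 a2 a3) by (rewrite T; lra).
  assert (HT : orient a1 a2 a3 <> 0) by (intro Z; rewrite Z in PT; lra).
  assert (Hk : k <> 0) by (intro Z; rewrite Z in PT; lra).
  split; [exact HT |].
  assert (Q : forall z, 0 < k * z -> 0 < z / orient a1 a2 a3).
  { intros z Hz. replace (z / orient a1 a2 a3) with ((k * z) / (k * orient a1 a2 a3))
      by (field; auto). now apply Rdiv_lt_0_compat. }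
  exists (orient o a2 a3 / orient a1 a2 a3), (orient o a3 a1 / orient a1 a2 a3),
         (orient o a1 a2 / orient a1 a2 a3).
  repeat split; auto.
  - rewrite T. field. rewrite <- T. exact HT.
  - destruct o; unfold orient in *; simpl in *. f_equal; field; exact HT.
Qed.

(** The ray from [o] away from [m] meets [G] at some [comb (- k) m o]. With
    [x := dot u m - dot u o > 0], the gap hypothesis at this point reads [- x < - k * x], whence
    [k < 1]. *)
Lemma opposite_point (G : pset) (a b c o u m : pt) :
  simple_closed_curve G -> hereditarily_csc G -> G a -> G b -> G c -> inside a b c o ->
  maximizer G u m -> (forall g, G g -> 2 * dot u o < dot u m + dot u g) ->
  exists k, 0 < k < 1 /\ G (comb (- k) m o).
Proof.
  intros HS H6 Ha Hb Hc Ho [Hm _] HD.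
  assert (Hmm := HD m Hm).
  destruct (ray_meets G a b c o (comb (-1) m o)) as (k & Hk & HG); auto.
  - intro E. rewrite <- E in Hmm at 1. unfold comb, dot in Hmm, E; simpl in Hmm, E.
    rewrite (surjective_pairing o) in E. injection E as E1 E2.
    assert (fst m = fst o) by lra. assert (snd m = snd o) by lra.
    rewrite H, H0 in Hmm. lra.
  - replace (comb k (comb (-1) m o) o) with (comb (- k) m o) in HG
      by (unfold comb; simpl; f_equal; ring).
    exists k. split; [| exact HG]. split; [exact Hk |].
    specialize (HD _ HG). unfold comb, dot in HD, Hmm; simpl in HD.
    apply Rnot_le_lt. intro H.
    assert (0 <= (k - 1) * (fst u * (fst m - fst o) + snd u * (snd m - snd o)))
      by (apply Rmult_le_pos; lra).
    lra.
Qed.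

Lemma no_three_wide_directions (G : pset) (u1 u2 u3 a1 a2 a3 o : pt) :
  simple_closed_curve G -> hereditarily_csc G ->
  fst u1 + fst u2 + fst u3 = 0 -> snd u1 + snd u2 + snd u3 = 0 ->
  maximizer G u1 a1 -> maximizer G u2 a2 -> maximizer G u3 a3 ->
  (forall g, G g -> 2 * dot u1 o < dot u1 a1 + dot u1 g) ->
  (forall g, G g -> 2 * dot u2 o < dot u2 a2 + dot u2 g) ->
  (forall g, G g -> 2 * dot u3 o < dot u3 a3 + dot u3 g) -> False.
Proof.
  intros HS H6 E1 E2 M1 M2 M3 D1 D2 D3.
  assert (Ho := inside_maximizers G u1 u2 u3 a1 a2 a3 o E1 E2 M1 M2 M3 D1 D2 D3).
  assert (G1 := proj1 M1). assert (G2 := proj1 M2). assert (G3 := proj1 M3).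
  destruct (opposite_point G a1 a2 a3 o u1 a1) as (k1 & K1 & H1); auto.
  destruct (opposite_point G a1 a2 a3 o u2 a2) as (k2 & K2 & H2); auto.
  destruct (opposite_point G a1 a2 a3 o u3 a3) as (k3 & K3 & H3); auto.
  exact (no_short_opposites G a1 a2 a3 o k1 k2 k3 H6 G1 G2 G3 Ho K1 K2 K3 H1 H2 H3).
Qed.

(** One inequality suffices: exchanging [v] with its opposite gives the other. *)
Lemma midstrip_center (G : pset) :
  simple_closed_curve G -> hereditarily_csc G ->
  exists O, forall v A B, maximizer G v A -> maximizer G (- fst v, - snd v) B ->
    dot v A + dot v B <= 2 * dot v O.
Proof.
  intros HS H6.
  destruct (maximizer_exists G (1, 0) HS) as (E & GE & HE).
  destruct (maximizer_exists G (-1, 0) HS) as (W & GW & HW).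
  destruct (maximizer_exists G (0, 1) HS) as (N & GN & HN).
  destruct (maximizer_exists G (0, -1) HS) as (S & GS & HSo).
  set (O := ((fst E + fst W) / 2, (snd N + snd S) / 2) : pt).
  unfold dot in HE, HW, HN, HSo; simpl in *.
  assert (X : forall k a g, maximizer G (k, 0) a -> G g ->
              2 * dot (k, 0) O <= dot (k, 0) a + dot (k, 0) g).
  { intros k a g [Ga Ma] Hg. assert (MaE := Ma E GE). assert (MaW := Ma W GW).
    assert (gE := HE g Hg). assert (gW := HW g Hg). unfold dot, O in *; simpl in *.
    destruct (Rle_lt_dec 0 k); nra. }
  assert (Y : forall k a g, maximizer G (0, k) a -> G g ->
              2 * dot (0, k) O <= dot (0, k) a + dot (0, k) g).
  { intros k a g [Ga Ma] Hg. assert (MaN := Ma N GN). assert (MaS := Ma S GS).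
    assert (gN := HN g Hg). assert (gS := HSo g Hg). unfold dot, O in *; simpl in *.
    destruct (Rle_lt_dec 0 k); nra. }
  exists O. intros [v1 v2] A B HA HB. simpl in HB.
  destruct (Req_dec v1 0) as [-> | N1].
  { rewrite Ropp_0 in HB. specialize (Y _ _ A HB (proj1 HA)).
    unfold dot in *; simpl in *. lra. }
  destruct (Req_dec v2 0) as [-> | N2].
  { rewrite Ropp_0 in HB. specialize (X _ _ A HB (proj1 HA)).
    unfold dot in *; simpl in *. lra. }
  apply Rnot_lt_le. intro Hgap.
  set (gap := dot (v1, v2) A + dot (v1, v2) B - 2 * dot (v1, v2) O).
  assert (Q1 : 0 < v1 * v1) by (apply Rsqr_pos_lt; exact N1).
  assert (Q2 : 0 < v2 * v2) by (apply Rsqr_pos_lt; exact N2).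
  (* Moving [O] by [d v] makes both axis inequalities strict, since [v1] and [v2] are nonzero, and
     uses up only half of the gap in direction [v]. *)
  set (d := gap / (4 * (v1 * v1 + v2 * v2))).
  assert (Hgap0 : 0 < gap) by (unfold gap; lra).
  assert (Hd : 0 < d) by (apply Rdiv_lt_0_compat; lra).
  assert (Ed : d * (v1 * v1 + v2 * v2) = gap / 4) by (unfold d; field; lra).
  destruct (maximizer_exists G (- v1, 0) HS) as (a1 & M1).
  destruct (maximizer_exists G (0, - v2) HS) as (a2 & M2).
  apply (no_three_wide_directions G (- v1, 0) (0, - v2) (v1, v2) a1 a2 A
           (fst O + d * v1, snd O + d * v2)); auto; simpl; try lra.
  - intros g Hg. specialize (X _ _ g M1 Hg). unfold dot in *; simpl in *. nra.
  - intros g Hg. specialize (Y _ _ g M2 Hg). unfold dot in *; simpl in *. nra.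
  - intros g Hg. assert (H := proj2 HB g Hg). unfold gap, dot in *; simpl in *. nra.
Qed.

(** * Separation from the hull and central symmetry *)

Lemma boundary_crossing (K : pset) (p q : pt) :
  K p -> ~ K q -> exists t, 0 <= t <= 1 /\ boundary K (comb t q p).
Proof.
  intros Hp Hq.
  (* The crossing is at the supremum [T] of [S]: points of [K] accumulate there from below, and
     beyond [T] the segment is outside [K]; if [T = 1], [q] itself is the outside point. *)
  set (S := fun t => 0 <= t <= 1 /\ K (comb t q p)).
  assert (S0 : S 0) by (split; [lra | now rewrite comb_0]).
  destruct (completeness S) as (T & Hub & Hlub).
  - exists 1. intros t [Ht _]. lra.
  - exists 0. exact S0.
  - assert (T0 : 0 <= T) by (apply Hub; exact S0).
    assert (T1 : T <= 1) by (apply Hlub; intros t [Ht _]; lra).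
    exists T. split; [lra |].
    set (d := dist2 q p). assert (Hd : 0 <= d) by apply sqrt_pos.
    assert (near : forall r t, Rabs (T - t) < r / (d + 1) -> 0 < r ->
                     dist2 (comb T q p) (comb t q p) < r).
    { intros r t Ht Hr. rewrite dist2_comb_l. fold d.
      assert (P := Rabs_pos (T - t)).
      assert (Rabs (T - t) * (d + 1) < r).
      { apply Rmult_lt_reg_r with (/ (d + 1)); [apply Rinv_0_lt_compat; lra |].
        rewrite Rmult_assoc, Rinv_r by lra. unfold Rdiv in Ht. lra. }
      nra. }
    split; intros r Hr; assert (He : 0 < r / (d + 1)) by (apply Rdiv_lt_0_compat; lra).
    + assert (exists t, S t /\ T - r / (d + 1) < t) as (t & [Ht HK] & Hlt).
      { apply NNPP. intro H. assert (T <= T - r / (d + 1)); [| lra].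
        apply Hlub. intros t Ht. apply Rnot_lt_le. intro. apply H. eauto. }
      exists (comb t q p). split; [exact HK |]. apply near; [| exact Hr].
      assert (t <= T) by (apply Hub; split; assumption). rewrite Rabs_right; lra.
    + destruct (Rle_lt_dec 1 T) as [H1 | H1].
      * exists q. split; [exact Hq |]. replace T with 1 by lra.
        rewrite comb_1, dist2_refl. exact Hr.
      * set (t := Rmin 1 (T + r / (d + 1) / 2)).
        assert (Ht : T < t <= 1) by (unfold t, Rmin; destruct (Rle_dec _ _); lra).
        assert (Ht' : t <= T + r / (d + 1) / 2) by apply Rmin_r.
        exists (comb t q p). split.
        -- intro HK. assert (t <= T) by (apply Hub; split; [lra | exact HK]). lra.
        -- apply near; [| exact Hr]. rewrite Rabs_left by lra. lra.
Qed.

(* A nearest point of [G] is a nearest point of the hull, as every segment from the hull to [z]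
   crosses [G]. *)
Lemma star_hull_separation (G : pset) (a b c o z : pt) :
  simple_closed_curve G -> hereditarily_csc G -> G a -> G b -> G c -> inside a b c o ->
  ~ star_hull G o z -> exists u, forall g, G g -> dot u g < dot u z.
Proof.
  intros HS H6 Ha Hb Hc Ho Hz.
  set (sq := fun p : pt => (fst z - fst p) * (fst z - fst p) + (snd z - snd p) * (snd z - snd p)).
  destruct (curve_attains_max G (fun p => - sq p) HS) as (w & Hw & Hmin).
  { intros x y Cx Cy. unfold sq; simpl. reg. }
  assert (HG : forall x, G x -> star_hull G o x) by (intro; apply star_hull_incl).
  exists (fst z - fst w, snd z - snd w).
  assert (Hpos : 0 < sq w).
  { unfold sq. assert (P1 := Rle_0_sqr (fst z - fst w)). assert (P2 := Rle_0_sqr (snd z - snd w)).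
    unfold Rsqr in P1, P2. apply Rnot_le_lt. intro H. apply Hz.
    assert (fst z - fst w = 0) by (apply Rsqr_0_uniq; unfold Rsqr; lra).
    assert (snd z - snd w = 0) by (apply Rsqr_0_uniq; unfold Rsqr; lra).
    replace z with w; [now apply HG |].
    rewrite (surjective_pairing z), (surjective_pairing w). f_equal; lra. }
  intros g Hg.
  enough (dot (fst z - fst w, snd z - snd w) g <= dot (fst z - fst w, snd z - snd w) w)
    by (unfold sq, dot in *; simpl in *; lra).
  apply Rnot_lt_le. intro Hlt.
  set (s := dot (fst z - fst w, snd z - snd w) g - dot (fst z - fst w, snd z - snd w) w).
  set (n := (fst g - fst w) * (fst g - fst w) + (snd g - snd w) * (snd g - snd w)).
  assert (Hn : 0 <= n).
  { unfold n. assert (P1 := Rle_0_sqr (fst g - fst w)). assert (P2 := Rle_0_sqr (snd g - snd w)).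
    unfold Rsqr in P1, P2. lra. }
  assert (Hs : 0 < s) by (unfold s; lra).
  (* This step keeps [e <= 1] and makes the change [e * e * n - 2 * e * s] of the squared distance
     equal to [- e * s * (1 + e)]. *)
  set (e := s / (s + n)).
  assert (He : 0 < e) by (apply Rdiv_lt_0_compat; lra).
  assert (Ee : e * (s + n) = s) by (unfold e; field; lra).
  assert (He1 : e <= 1) by nra.
  assert (Hy : star_hull G o (comb e g w)).
  { apply (star_hull_convex G a b c o); auto. lra. }
  assert (Hsq : sq (comb e g w) < sq w).
  { replace (sq (comb e g w)) with (sq w - 2 * e * s + e * (e * n))
      by (unfold sq, s, n, dot, comb; simpl; ring).
    replace (e * n) with (s - e * s) by lra. nra. }
  destruct (boundary_crossing _ _ z Hy Hz) as (t & Ht & Hbd).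
  apply (star_hull_boundary G a b c o) in Hbd; auto.
  specialize (Hmin _ Hbd). simpl in Hmin.
  replace (sq (comb t z (comb e g w))) with ((1 - t) * (1 - t) * sq (comb e g w)) in Hmin
    by (unfold sq, comb; simpl; ring).
  assert (0 <= sq (comb e g w)).
  { unfold sq. assert (P1 := Rle_0_sqr (fst z - fst (comb e g w))).
    assert (P2 := Rle_0_sqr (snd z - snd (comb e g w))). unfold Rsqr in P1, P2. lra. }
  assert (0 <= (1 - t) * (1 - t) <= 1) by nra.
  nra.
Qed.

Lemma reflect_comb (O x y : pt) (t : R) :
  reflect O (comb t x y) = comb t (reflect O x) (reflect O y).
Proof. unfold reflect, comb; simpl. f_equal; ring. Qed.

Lemma interior_reflect (K : pset) (O x : pt) :
  symmetric_about O K -> interior K x -> interior K (reflect O x).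
Proof.
  intros HK (r & Hr & H). exists r. split; [exact Hr |]. intros y Hy.
  rewrite <- (reflect_involutive O y). apply HK, H.
  rewrite <- (dist2_reflect O), reflect_involutive. exact Hy.
Qed.

Theorem theorem2 (G : pset) :
  simple_closed_curve G ->
  (forall p1 p2 p3 p4 p5 p6 : pt,
     G p1 -> G p2 -> G p3 -> G p4 -> G p5 -> G p6 ->
     p1 <> p2 -> p1 <> p3 -> p1 <> p4 -> p1 <> p5 -> p1 <> p6 ->
     p2 <> p3 -> p2 <> p4 -> p2 <> p5 -> p2 <> p6 ->
     p3 <> p4 -> p3 <> p5 -> p3 <> p6 ->
     p4 <> p5 -> p4 <> p6 -> p5 <> p6 ->
     csc_position (fun x => x = p1 \/ x = p2 \/ x = p3 \/ x = p4 \/ x = p5 \/ x = p6)) ->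
  exists (O : pt) (K : pset),
    convex_body K /\ symmetric_about O K /\
    (forall x, boundary K x <-> G x) /\
    (forall x, G x -> G (reflect O x)).
Proof.
  intros HS Hsix.
  assert (H6 : hereditarily_csc G).
  { intros l Hlen Hl.
    destruct (curve_extend G l 6 HS Hl Hlen) as (l' & E & ND & I & Hl').
    destruct l' as [| p1 [| p2 [| p3 [| p4 [| p5 [| p6 [|]]]]]]]; try discriminate E.
    rewrite !NoDup_cons_iff in ND. simpl in ND.
    destruct (Hsix p1 p2 p3 p4 p5 p6) as (K & HK & HKs & Hbd); try (apply Hl'; simpl; tauto);
      try (intros ->; tauto).
    exists K. split; [exact HK |]. split; [exact HKs |].
    intros x Hx. apply Hbd. specialize (I x Hx). simpl in I.
    destruct I as [<- | [<- | [<- | [<- | [<- | [<- | []]]]]]]; tauto. }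
  destruct (noncollinear G HS) as (a & b & c & Ha & Hb & Hc & Habc).
  assert (Ho := centroid_inside a b c Habc).
  set (o := ((fst a + fst b + fst c) / 3, (snd a + snd b + snd c) / 3) : pt) in *.
  destruct (midstrip_center G HS H6) as (O & HO).
  set (K := star_hull G o).
  assert (Kconv : convex K) by now apply (star_hull_convex G a b c o).
  assert (Kbd : forall x, boundary K x <-> G x)
    by (intro x; now apply (star_hull_boundary G a b c o)).
  assert (HG : forall x, G x -> K x) by (intro; apply star_hull_incl).
  (* A direction [u] separating the reflection of [g] from [G] would violate the support inequality
     of [midstrip_center] at [- u]. *)
  assert (Gsym : forall g, G g -> K (reflect O g)).
  { intros g Hg. apply NNPP. intro Hn.
    destruct (star_hull_separation G a b c o (reflect O g)) as (u & Hu); auto.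
    destruct (maximizer_exists G (- fst u, - snd u) HS) as (A & HA).
    destruct (maximizer_exists G u HS) as (B & HB).
    assert (Hle := HO (- fst u, - snd u) A B HA).
    simpl in Hle. rewrite !Ropp_involutive, <- surjective_pairing in Hle. specialize (Hle HB).
    assert (HAg := proj2 HA g Hg). assert (HuB := Hu B (proj1 HB)).
    unfold dot, reflect in *; simpl in *. lra. }
  assert (Ksym : symmetric_about O K).
  { assert (Kconv' : convex (fun x => K (reflect O x))).
    { intros x y t Hx Hy Ht. rewrite reflect_comb. now apply Kconv. }
    intros x (g & t & Hg & Ht & ->).
    apply (Kconv' g o t); auto.
    apply (convex_inside _ a b c o Kconv'); auto. }
  exists O, K. split; [| split; [exact Ksym | split; [exact Kbd |]]].
  - split; [exact Kconv |]. split; [now apply (star_hull_closed G a b c o) |].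
    split; [now apply star_hull_bounded |].
    exists o. apply (inside_interior K a b c); auto.
  - intros x Hx. destruct (Gsym x Hx) as (g & t & Hg & Ht & E).
    (* If [t < 1], the reflection of [x] is interior to [K], and by symmetry so is [x], which is on
       the boundary. *)
    destruct (Req_dec t 1) as [-> | Ht1]; [rewrite E, comb_1; exact Hg |].
    exfalso. apply (interior_not_boundary K x); [| now apply Kbd].
    rewrite <- (reflect_involutive O x). apply interior_reflect; [exact Ksym |].
    rewrite E. apply (star_hull_interior G a b c o); auto. lra.
Qed.
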